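(* For each $\beta>1$ there exist a positive, uniformly $\beta$-Kreiss bounded operator $T_\beta$ on $\ell^2(\mathbb{N})$ and a constant $C>0$ such that $\|T_\beta^N\|\ge C N^{\beta}$ for all $N\in\mathbb{N}$.
   Context: $\mathbb{N}=\{1,2,\dots\}$; $\ell^2(\mathbb{N})$ is the complex Hilbert space with its usual coordinatewise Banach lattice structure, and positive means mapping vectors with nonnegative coordinates to vectors with nonnegative coordinates. A bounded operator $T$ is uniformly $\beta$-Kreiss bounded if there is $C>0$ such that $\Big\|\sum_{j=0}^n\frac{T^j}{\lambda^{j+1}}\Big\|\le\frac{C}{(|\lambda|-1)^{\beta}}$ for all $1<|\lambda|<2$ and all $n\in\mathbb{N}$. *)

(* Defs.v *)
From HB Require Import structures.
From mathcomp Require Import all_boot all_order all_algebra.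
From mathcomp Require Import all_classical all_reals all_analysis.
From mathcomp Require Export complex.
From mathcomp Require Import lra.

Set Implicit Arguments.
Unset Strict Implicit.
Unset Printing Implicit Defensive.

Import Order.TTheory GRing.Theory Num.Theory.
Import numFieldNormedType.Exports.

Local Open Scope ring_scope.
Local Open Scope complex_scope.

(* The norm of R[i] as a numFieldType is itself R[i]-valued: the real-valued
   modulus is Normc.normc, with `|z| = (cmod z)%:C. *)
Notation cmod := Normc.normc.

Section Ell2.
Context (R : realType).

(* Coordinates are indexed by nat, x k being the (k+1)-st coordinate. *)
Definition sqsum (x : nat -> R[i]) : \bar R :=
  (\sum_(0 <= k <oo) (cmod (x k) ^+ 2)%:E)%E.

Definition sqsummable : pred (nat -> R[i]) := fun x => (sqsum x < +oo)%E.

Lemma sqsummable_submod_closed : submod_closed sqsummable.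
Proof.
split.
  rewrite /in_mem /= /sqsummable /sqsum eseries0 ?ltry// => k _ _.
  by rewrite Normc.normc0 expr0n.
move=> a x y; rewrite /in_mem /= /sqsummable /sqsum => hx hy.
have ge0 (c : R) (z : nat -> R[i]) (k : nat) :
    0 <= c -> (0 <= (c * cmod (z k) ^+ 2)%:E)%E.
  by move=> c0; rewrite lee_fin mulr_ge0// sqr_ge0.
have ge01 (z : nat -> R[i]) (k : nat) : (0 <= (cmod (z k) ^+ 2)%:E)%E.
  by rewrite lee_fin sqr_ge0.
set ca := 2 * cmod a ^+ 2.
have ca0 : 0 <= ca by rewrite mulr_ge0// sqr_ge0.
apply: (@le_lt_trans _ _ (\sum_(0 <= k <oo)
    ((ca * cmod (x k) ^+ 2)%:E + (2 * cmod (y k) ^+ 2)%:E))%E).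
  apply: lee_nneseries => k _; first by move=> _; exact: ge01.
  rewrite -EFinD lee_fin.
  have N0 (z : R[i]) : 0 <= cmod z by case: z => u v; rewrite sqrtr_ge0.
  apply: (@le_trans _ _ ((cmod a * cmod (x k) + cmod (y k)) ^+ 2)).
    rewrite ler_pXn2r ?nnegrE ?addr_ge0 ?mulr_ge0//.
    by rewrite -Normc.normcM; exact: le_normcD.
  rewrite /ca; set u := cmod a; set v := cmod (x k); set w := cmod (y k).
  have := sqr_ge0 (u * v - w); nra.
rewrite nneseriesD; [|by move=> *; exact: ge0..].
under eq_eseriesr do rewrite EFinM.
under [X in (_ + X)%E]eq_eseriesr do rewrite EFinM.
rewrite !nneseriesZl; [|by move=> *; exact: ge01..].
by rewrite lte_add_pinfty// lte_mul_pinfty// lee_fin.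
Qed.

HB.instance Definition _ := GRing.isSubmodClosed.Build _ _ sqsummable
  sqsummable_submod_closed.

Record ell2 := Ell2 { ell2_seq :> nat -> R[i]; ell2P : sqsummable ell2_seq }.

HB.instance Definition _ := [isSub for ell2_seq].
HB.instance Definition _ := [Choice of ell2 by <:].
HB.instance Definition _ := [SubChoice_isSubLmodule of ell2 by <:].

Definition l2norm (x : ell2) : R := Num.sqrt (fine (sqsum x)).

Definition bounded_op (T : ell2 -> ell2) : Prop :=
  exists M : R, forall x, l2norm (T x) <= M * l2norm x.

(* The real-valued supremum is meaningful only for bounded operators: sup of
   an unbounded set is 0. *)
Definition opnorm (T : ell2 -> ell2) : R :=
  sup [set l2norm (T x) | x in [set x | l2norm x <= 1]]%classic.

(* In R[i], 0 <= z means that z is real and nonnegative. *)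
Definition positive_op (T : ell2 -> ell2) : Prop :=
  forall x : ell2, (forall k, 0 <= x k) -> forall k, 0 <= T x k.

Definition kreiss_sum (T : ell2 -> ell2) (lambda : R[i]) (n : nat) (x : ell2) :
    ell2 :=
  \sum_(0 <= j < n.+1) (lambda ^- j.+1) *: iter j T x.

Definition uniformly_kreiss_bounded (beta : R) (T : ell2 -> ell2) : Prop :=
  exists2 C : R, 0 < C &
    forall (lambda : R[i]) (n : nat), 1 < cmod lambda < 2 -> (0 < n)%N ->
      opnorm (kreiss_sum T lambda n) <= C / ((cmod lambda - 1) `^ beta).

End Ell2.

(* Main.v *)
Require Import Defs.
From HB Require Import structures.
From mathcomp Require Import all_boot all_order all_algebra.
From mathcomp Require Import all_classical all_reals all_analysis.
From mathcomp Require Import zify ring lra.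

(* Let T be the weighted shift that is a direct sum of nilpotent blocks, the
   N-th block acting on e_0, ..., e_N by e_i |-> (w_(i+1) / w_i) e_(i+1) with
   w_i = ((1 + i) / (1 + N - i)) ^ (beta / 2).  Then T^N maps e_0 to
   (N + 1) ^ beta e_N, whence the lower bound.

   T is positive, so for |lambda| = 1 + t the Kreiss sums are dominated
   entrywise by the kernel (1 + t) ^ (- d) (w_j / w_i), with d = j - i.  From
   1 + d / m <= (1 + t d) (1 + 1 / (t m)) and
   (1 + t) ^ (- d) (1 + t d) ^ beta <= C exp (- t d / 4) it is at most
   C exp (- t d / 4) P_i Q_j, where P_i = (1 + 1 / (t (1 + i))) ^ (beta / 2) and
   Q_j = (1 + 1 / (t (1 + N - j))) ^ (beta / 2).  As the series of
   (1 + i) ^ (- beta) converges for beta > 1, the sums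
   sum_i exp (- t d / 4) P_i ^ 2 and sum_j exp (- t d / 4) Q_j ^ 2 are
   O(t ^ (- beta)), and the Schur test with weights P and Q concludes. *)

Set Implicit Arguments.
Unset Strict Implicit.
Unset Printing Implicit Defensive.

Import Order.TTheory GRing.Theory Num.Theory.
Local Open Scope ring_scope.

Lemma eq_ler (R : numDomainType) (x y : R) : x = y -> x <= y.
Proof. by move->. Qed.

(** * The Schur test for finite sums *)

Section SchurTest.
Context (R : realType).

(** Expanding the nonnegative sum of w_i (c y_i - S p_i)^2 and using [A <= c] gives c S^2 <= c^2 Y;
    working with the bound [c] instead of [A] avoids dividing by a sum that may vanish. *)
Lemma weighted_cauchy_schwarz (I : Type) (r : seq I) (w p y : I -> R) (c : R) :
  0 < c -> (forall i, 0 <= w i) ->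
  \sum_(i <- r) w i * p i ^+ 2 <= c ->
  (\sum_(i <- r) w i * p i * y i) ^+ 2 <= c * \sum_(i <- r) w i * y i ^+ 2.
Proof.
move=> c0 w0; set S := \sum_(i <- r) w i * p i * y i.
set A := \sum_(i <- r) w i * p i ^+ 2; set Y := \sum_(i <- r) w i * y i ^+ 2.
move=> Ac.
have : 0 <= \sum_(i <- r) w i * (c * y i - S * p i) ^+ 2.
  by apply: sumr_ge0 => i _; rewrite mulr_ge0 ?sqr_ge0.
have -> : \sum_(i <- r) w i * (c * y i - S * p i) ^+ 2 =
    c ^+ 2 * Y - 2 * c * S * S + S ^+ 2 * A.
  transitivity (\sum_(i <- r) (c ^+ 2 * (w i * y i ^+ 2) +
      - (2 * c * S) * (w i * p i * y i) + S ^+ 2 * (w i * p i ^+ 2))).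
    by apply: eq_bigr => i _; ring.
  by rewrite !big_split/= -!mulr_sumr mulNr.
move=> h; rewrite -(ler_pM2l c0).
have := ler_wpM2l (sqr_ge0 S) Ac; lra.
Qed.

(** The Schur weights are factored out of the kernel w_jk p_k q_j. Cauchy-Schwarz in each row
    consumes the sums of p^2; after exchanging the sums, the columns consume those of q^2. *)
Lemma schur_test (w : nat -> nat -> R) (p q x : nat -> R) (c : R) (M : nat) :
  0 < c -> (forall j k, 0 <= w j k) ->
  (forall j, (j < M)%N -> \sum_(0 <= k < M) w j k * p k ^+ 2 <= c) ->
  (forall k, (k < M)%N -> \sum_(0 <= j < M) w j k * q j ^+ 2 <= c) ->
  \sum_(0 <= j < M) (\sum_(0 <= k < M) w j k * p k * q j * x k) ^+ 2 <=
    c ^+ 2 * \sum_(0 <= k < M) x k ^+ 2.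
Proof.
move=> c0 w0 hp hq.
apply: (@le_trans _ _ (\sum_(0 <= j < M)
   c * \sum_(0 <= k < M) w j k * q j ^+ 2 * x k ^+ 2)).
  rewrite big_nat [leRHS]big_nat; apply: ler_sum => j /andP[_ jM].
  have := weighted_cauchy_schwarz (fun k => q j * x k) c0 (w0 j) (hp j jM).
  by under eq_bigr do rewrite mulrA; under [in leRHS]eq_bigr do
    rewrite exprMn mulrA.
rewrite -mulr_sumr expr2 -mulrA ler_pM2l// exchange_big/= mulr_sumr.
rewrite big_nat [leRHS]big_nat; apply: ler_sum => k /andP[_ kM].
by rewrite -mulr_suml ler_wpM2r ?sqr_ge0 ?hq.
Qed.

End SchurTest.

(** * Real estimates for powers, exponentials and the weighted edge sums *)

Section Estimates.
Context (R : realType).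
Implicit Types b t x y : R.

Lemma ler_powR2 b x y : 0 <= b -> 0 <= x -> x <= y -> x `^ b <= y `^ b.
Proof.
move=> b0 x0 xy.
by apply: ge0_ler_powR => //; rewrite nnegrE// (le_trans x0).
Qed.

Lemma powR_div x y b : 0 <= x -> 0 <= y -> (x / y) `^ b = x `^ b / y `^ b.
Proof.
move=> x0 y0; rewrite powRM ?invr_ge0//.
by rewrite -[y^-1]powR_inv1// -powRrM mulN1r powRN.
Qed.

(** Raise u <= exp u, taken at u = (1 + y) / (4 b), to the power b. The rate 1/4 is half of the
    decay rate 1/2 in [exprV_le_expR], so a decay of rate 1/4 survives. *)
Lemma powR_le_expR b : 0 < b ->
  exists2 C : R, 0 < C & forall y, 0 <= y -> (1 + y) `^ b <= C * expR (y / 4).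
Proof.
move=> b0; exists ((4 * b) `^ b * expR (1 / 4)).
  by rewrite mulr_gt0 ?expR_gt0 ?powR_gt0 ?mulr_gt0.
move=> y y0.
have h : 1 + y <= 4 * b * expR ((1 + y) / (4 * b)).
  rewrite mulrC -ler_pdivrMr ?mulr_gt0//.
  by apply: le_trans (expR_ge1Dx _); rewrite lerDr.
apply: le_trans (ler_powR2 (ltW b0) _ h) _; first by rewrite addr_ge0.
rewrite powRM ?expR_ge0 ?mulr_ge0 ?(ltW b0)// -expRM -[leRHS]mulrA -expRD.
rewrite ler_wpM2l ?powR_ge0// ler_expR; apply: eq_ler.
by field; rewrite lt0r_neq0.
Qed.

Lemma powRD_le b y : 0 <= b -> 0 <= y -> (1 + y) `^ b <= 2 `^ b * (1 + y `^ b).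
Proof.
move=> b0 y0; have [y1|y1] := leP y 1.
  rewrite -[leLHS]mulr1; apply: ler_pM; rewrite ?powR_ge0 ?ler_powR2//; try lra.
  by rewrite lerDl powR_ge0.
apply: (@le_trans _ _ ((2 * y) `^ b)); first by rewrite ler_powR2//; lra.
by rewrite powRM// ler_wpM2l ?powR_ge0// lerDr.
Qed.

(** A discrete form of comparing the sum of x^(-b) with its integral: the right-hand side
    telescopes. *)
Lemma inv_powR_step b (n : nat) : 1 < b ->
  (b - 1) * (n.+2%:R `^ b)^-1 <=
    (n.+1%:R `^ (b - 1))^-1 - (n.+2%:R `^ (b - 1))^-1.
Proof.
move=> b1; have b10 : 0 < b - 1 by rewrite subr_gt0.
have n2 : 0 < n.+2%:R :> R by [].
have n1 : 0 < n.+1%:R :> R by [].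
have bE : n.+2%:R `^ b = n.+2%:R * n.+2%:R `^ (b - 1) :> R.
  by rewrite mulrC -[X in _ * X]powRr1 ?ltW// -powRD ?subrK// pnatr_eq0 implybT.
have p2 : 0 < n.+2%:R `^ (b - 1) :> R by rewrite powR_gt0.
have p1 : 0 < n.+1%:R `^ (b - 1) :> R by rewrite powR_gt0.
rewrite bE.
suff h : 1 + (b - 1) / n.+2%:R <= n.+2%:R `^ (b - 1) / n.+1%:R `^ (b - 1).
  rewrite -(ler_pM2l p2) mulrBr mulfV ?lt0r_neq0//.
  rewrite lerBrDr addrC; apply: le_trans h; rewrite lerD2l invfM.
  by apply: eq_ler; field; rewrite !lt0r_neq0.
(* This is 1 - u <= exp(- u) at u = 1 / (n + 2); its power b - 1 is then played against 1 + (b - 1)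
   u <= exp((b - 1) u). *)
have h1 : n.+1%:R <= n.+2%:R * expR (- n.+2%:R^-1) :> R.
  apply: le_trans (ler_wpM2l (ltW n2) (expR_ge1Dx _)).
  by rewrite mulrDr mulr1 mulrN mulfV ?lt0r_neq0// -[in leRHS]natr1 addrK.
have h2 := ler_powR2 (ltW b10) (ltW n1) h1.
rewrite powRM ?expR_ge0 ?(ltW n2)// -expRM in h2; rewrite ler_pdivlMr//.
have h3 := expR_ge1Dx ((b - 1) / n.+2%:R).
have e0 : 0 <= 1 + (b - 1) / n.+2%:R.
  by rewrite addr_ge0// divr_ge0// subr_ge0 ltW.
apply: le_trans (ler_wpM2l e0 h2) _.
rewrite mulrCA -[leRHS]mulr1 ler_wpM2l ?powR_ge0//.
apply: le_trans (ler_wpM2r (expR_ge0 _) h3) _.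
by rewrite -expRD mulNr mulrC subrr expR0.
Qed.

Lemma riemann_sum_bounded b : 1 < b ->
  exists2 S : R, 0 < S &
    forall n : nat, \sum_(0 <= k < n) (k.+1%:R `^ b)^-1 <= S.
Proof.
move=> b1; have b10 : 0 < b - 1 by rewrite subr_gt0.
(* The 1 is the first term; the remaining terms telescope to at most 1 / (b - 1). *)
exists (1 + (b - 1)^-1); first by rewrite addr_gt0 ?invr_gt0.
case=> [|n]; first by rewrite big_geq// addr_ge0// invr_ge0 ltW.
rewrite big_nat_recl//= powR1 invr1 lerD2l.
rewrite -[leRHS]mulr1 mulrC -ler_pdivrMr ?invr_gt0// invrK mulrC mulr_sumr.
apply: (@le_trans _ _ (\sum_(0 <= k < n)
    ((k.+1%:R `^ (b - 1))^-1 - (k.+2%:R `^ (b - 1))^-1))).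
  by apply: ler_sum => k _; exact: inv_powR_step.
have -> : \sum_(0 <= k < n) ((k.+1%:R `^ (b - 1))^-1 - (k.+2%:R `^ (b - 1))^-1)
    = 1 - (n.+1%:R `^ (b - 1))^-1 :> R.
  elim: n => [|n IH]; first by rewrite big_geq// powR1 invr1 subrr.
  by rewrite big_nat_recr//= IH addrA subrK.
by rewrite gerBl invr_ge0 powR_ge0.
Qed.

Lemma geometric_expR_sum t (n : nat) : 0 < t <= 1 ->
  \sum_(0 <= d < n) expR (- (t * d%:R / 4)) <= 8 / t.
Proof.
move=> /andP[t0 t1].
set e := expR (- (t / 4)).
have e0 : 0 < e by exact: expR_gt0.
(* From (1 + t/4) e <= 1 and t <= 1 one even gets t/5; 8 is a convenient constant. *)
have he : t / 8 <= 1 - e.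
  have : (1 + t / 4) * e <= 1.
    rewrite /e expRN ler_pdivrMr ?expR_gt0// mul1r; exact: expR_ge1Dx.
  nra.
have -> : \sum_(0 <= d < n) expR (- (t * d%:R / 4)) = \sum_(0 <= d < n) e ^+ d.
  by apply: eq_bigr => d _; rewrite /e -expRM_natl; congr expR; field.
have h : (1 - e) * \sum_(0 <= d < n) e ^+ d = 1 - e ^+ n.
  elim: n => [|n IH]; first by rewrite big_geq// mulr0 expr0 subrr.
  by rewrite big_nat_recr//= mulrDr IH exprS; ring.
have en : 0 <= e ^+ n by rewrite exprn_ge0// ltW.
rewrite ler_pdivlMr//.
have S0 : 0 <= \sum_(0 <= d < n) e ^+ d.
  by apply: sumr_ge0 => d _; rewrite exprn_ge0// ltW.
nra.
Qed.

(* The weights P and Q of the Schur test, [j] being the distance to an end of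
   the block. *)
Definition edge b t (j : nat) : R := (1 + (t * j.+1%:R)^-1) `^ (b / 2).

Lemma edge_sqr b t j : 0 < t -> edge b t j ^+ 2 = (1 + (t * j.+1%:R)^-1) `^ b.
Proof.
move=> t0.
by rewrite /edge -powR_mulrn ?powR_ge0// -powRrM -mulrA mulVf ?mulr1.
Qed.

(** By [powRD_le] the squared weight is at most 2^b (1 + t^(-b) m^(-b)) with m = j - d + 1. The
    first term leaves a geometric sum of order 1/t; in the second the exponential is bounded by 1
    and the series of m^(-b) converges. *)
Lemma edge_sum_bounded b : 1 < b ->
  exists2 C : R, 0 < C & forall t (j : nat), 0 < t <= 1 ->
    \sum_(0 <= d < j.+1) expR (- (t * d%:R / 4)) * edge b t (j - d) ^+ 2 <=
      C / t `^ b.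
Proof.
move=> b1; have [S S0 hS] := riemann_sum_bounded b1.
have b0 : 0 < b by lra.
have c0 : 0 < 2 `^ b :> R by rewrite powR_gt0.
exists (2 `^ b * (8 + S)); first by rewrite mulr_gt0// addr_gt0.
move=> t j /[dup] t01 /andP[t0 t1].
have tb0 : 0 < t `^ b by rewrite powR_gt0.
rewrite -mulrA mulrDl.
apply: (@le_trans _ _ (2 `^ b * \sum_(0 <= d < j.+1)
   (expR (- (t * d%:R / 4)) + ((j - d).+1%:R `^ b)^-1 / t `^ b))).
  rewrite mulr_sumr; apply: ler_sum => d _.
  rewrite edge_sqr//.
  have i0 : 0 <= (t * (j - d).+1%:R)^-1 by rewrite invr_ge0 mulr_ge0// ltW.
  apply: le_trans (ler_wpM2l (expR_ge0 _) (powRD_le (ltW b0) i0)) _.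
  rewrite mulrCA ler_pM2l// mulrDr mulr1 lerD2l.
  have -> : (t * (j - d).+1%:R)^-1 `^ b = ((j - d).+1%:R `^ b)^-1 / t `^ b.
    rewrite -div1r powR_div ?mulr_ge0 ?(ltW t0)// powR1.
    by rewrite powRM ?(ltW t0)// div1r invfM mulrC.
  rewrite -[leRHS]mul1r ler_wpM2r ?divr_ge0 ?invr_ge0 ?powR_ge0//.
  by rewrite -expR0 ler_expR oppr_le0 divr_ge0// mulr_ge0// ltW.
rewrite ler_pM2l// big_split/= lerD//.
  apply: le_trans (geometric_expR_sum _ t01) _.
  (* As t <= 1 < b, t^b <= t, so the order 1/t fits under t^(-b). *)
  rewrite ler_pM2l// lef_pV2 ?posrE//.
  have := ger_powR; move/(_ _ t t01 1 b (ltW b1)).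
  by rewrite powRr1// ltW.
rewrite -mulr_suml ler_wpM2r ?invr_ge0 ?powR_ge0//.
apply: le_trans (hS j.+1).
by rewrite [leRHS]big_nat_rev/= add0n.
Qed.

(** Compare (1 - t/2) exp(t/2) <= 1 with (1 - t/2) (1 + t) >= 1, which holds on [0, 1]. *)
Lemma expR_half_le t : 0 <= t <= 1 -> expR (t / 2) <= 1 + t.
Proof.
move=> /andP[t0 t1].
have := expR_ge1Dx (- (t / 2)); rewrite expRN => h.
have e0 := expR_gt0 (t / 2).
have : (1 - t / 2) * expR (t / 2) <= 1 by rewrite -ler_pdivlMr// div1r.
nra.
Qed.

Lemma exprV_le_expR t (d : nat) : 0 <= t <= 1 ->
  (1 + t) ^- d <= expR (- (t * d%:R / 2)).
Proof.
move=> t01; rewrite expRN mulrAC expRM_natr.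
have t0 : 0 < 1 + t by case/andP: t01; lra.
rewrite lef_pV2 ?posrE ?exprn_gt0 ?expR_gt0//.
by rewrite lerXn2r ?nnegrE ?expR_ge0 ?(ltW t0) ?expR_half_le.
Qed.

Lemma ratio_powR_le_edge b t (m d : nat) : 0 <= b -> 0 < t ->
  ((m + d).+1%:R / m.+1%:R) `^ (b / 2) <=
    (1 + t * d%:R) `^ (b / 2) * edge b t m.
Proof.
move=> b0 t0.
have m0 : 0 < m.+1%:R :> R by [].
have d0 : 0 <= d%:R :> R by [].
rewrite /edge -powRM ?addr_ge0 ?invr_ge0 ?mulr_ge0 ?(ltW t0)//.
apply: ler_powR2; rewrite ?divr_ge0//.
have -> : (m + d).+1%:R / m.+1%:R = 1 + d%:R / m.+1%:R :> R.
  by rewrite -addSn natrD mulrDl divff ?lt0r_neq0.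
have -> : (1 + t * d%:R) * (1 + (t * m.+1%:R)^-1) =
    1 + d%:R / m.+1%:R + (t * d%:R + (t * m.+1%:R)^-1).
  by field; rewrite !lt0r_neq0.
by rewrite lerDl addr_ge0 ?invr_ge0 ?mulr_ge0 ?(ltW t0).
Qed.

End Estimates.

(** * Coordinates, norms and operator norms in the sequence space *)

Section Ell2Norm.
Context (R : realType).
Local Open Scope complex_scope.
Implicit Types x y : ell2 R.

Lemma ell2Z (a : R[i]) x k : (a *: x) k = a * x k. Proof. by []. Qed.

Lemma ell2_sum (n : nat) (f : nat -> ell2 R) k :
  (\sum_(0 <= j < n) f j) k = \sum_(0 <= j < n) f j k.
Proof.
elim: n => [|n IH]; first by rewrite !big_geq.
by rewrite !big_nat_recr//= -IH.
Qed.

Lemma cmod_ge0 (z : R[i]) : 0 <= cmod z.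
Proof. by case: z => a b; exact: sqrtr_ge0. Qed.

Lemma cmod_real (a : R) : cmod a%:C = `|a|.
Proof. by rewrite /= expr0n addr0 sqrtr_sqr. Qed.

Lemma cmodVX (z : R[i]) (n : nat) : cmod (z ^- n) = cmod z ^- n.
Proof.
rewrite Normc.normcV; congr _^-1.
by elim: n => [|n IH]; rewrite ?expr0 ?Normc.normc1// !exprS Normc.normcM IH.
Qed.

Lemma cmod_sum_le (I : Type) (r : seq I) (P : pred I) (f : I -> R[i]) :
  cmod (\sum_(i <- r | P i) f i) <= \sum_(i <- r | P i) cmod (f i).
Proof.
elim/big_rec2 : _ => [|i u v _ h]; first by rewrite Normc.normc0.
by apply: le_trans (le_normcD _ _) _; rewrite lerD2l.
Qed.

Lemma sqsum_ge0 (x : nat -> R[i]) : (0 <= sqsum x)%E.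
Proof. by apply: nneseries_ge0 => k _ _; rewrite lee_fin sqr_ge0. Qed.

(** The same cutoff [M] on both sides suits lower triangular operators, where y_j depends only on
    the x_k with k <= j, and reduces their bounds to finite sums. *)
Lemma sqsum_le (x y : nat -> R[i]) (c : R) :
  (forall M : nat, \sum_(0 <= k < M) cmod (y k) ^+ 2 <=
     c ^+ 2 * \sum_(0 <= k < M) cmod (x k) ^+ 2) ->
  (sqsum y <= (c ^+ 2)%:E * sqsum x)%E.
Proof.
move=> h; have ge0 (z : nat -> R[i]) (k : nat) : (0 <= (cmod (z k) ^+ 2)%:E)%E.
  by rewrite lee_fin sqr_ge0.
apply: lime_le; first by apply: is_cvg_nneseries => k _ _; exact: ge0.
apply: nearW => M; rewrite sumEFin.
apply: (@le_trans _ _ (c ^+ 2 * \sum_(0 <= k < M) cmod (x k) ^+ 2)%:E).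
  by rewrite lee_fin.
rewrite EFinM -sumEFin lee_wpmul2l ?lee_fin ?sqr_ge0//.
by apply: nneseries_lim_ge => k _ _; exact: ge0.
Qed.

Lemma l2norm_ge0 x : 0 <= l2norm x.
Proof. exact: sqrtr_ge0. Qed.

Lemma l2norm0 : l2norm (0 : ell2 R) = 0.
Proof.
rewrite /l2norm /sqsum eseries0 ?sqrtr0// => k _ _.
by rewrite Normc.normc0 expr0n.
Qed.

Lemma l2norm_le x y (c : R) : 0 <= c ->
  (forall M : nat, \sum_(0 <= k < M) cmod (y k) ^+ 2 <=
     c ^+ 2 * \sum_(0 <= k < M) cmod (x k) ^+ 2) ->
  l2norm y <= c * l2norm x.
Proof.
move=> c0 /sqsum_le h.
have fin (z : ell2 R) : sqsum z \is a fin_num.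
  by rewrite ge0_fin_numE ?sqsum_ge0//; exact: (ell2P z).
rewrite /l2norm -[X in X * _](ger0_norm c0) -sqrtr_sqr -sqrtrM ?sqr_ge0//.
by rewrite ler_wsqrtr// -lee_fin EFinM !fineK.
Qed.

Lemma opnorm_le (T : ell2 R -> ell2 R) (c : R) : 0 <= c ->
  (forall x, l2norm (T x) <= c * l2norm x) -> opnorm T <= c.
Proof.
move=> c0 h; apply: ge_sup.
  by exists (l2norm (T 0)), 0 => //=; rewrite l2norm0.
move=> _ [x /= x1 <-]; apply: le_trans (h x) _.
by rewrite -[leRHS]mulr1 ler_wpM2l.
Qed.

Lemma opnorm_ge (T : ell2 R -> ell2 R) x : bounded_op T -> l2norm x <= 1 ->
  l2norm (T x) <= opnorm T.
Proof.
move=> [M hM] x1; apply: ub_le_sup; last by exists x.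
(* [M] may be negative, hence the absolute value. *)
exists `|M| => _ [y /= y1 <-]; apply: le_trans (hM y) _.
apply: le_trans (ler_wpM2r (l2norm_ge0 y) (ler_norm M)) _.
by rewrite -[leRHS]mulr1 ler_wpM2l.
Qed.

Lemma bounded_op_iter (T : ell2 R -> ell2 R) (n : nat) :
  bounded_op T -> bounded_op (iter n T).
Proof.
move=> [M hM]; elim: n => [|n [L hL]]; first by exists 1 => x; rewrite mul1r.
exists (`|M| * L) => x /=; apply: le_trans (hM _) _.
apply: le_trans (ler_wpM2r (l2norm_ge0 _) (ler_norm M)) _.
by rewrite -mulrA ler_wpM2l.
Qed.

Lemma sqsum_delta (z : R[i]) (k : nat) :
  sqsum (fun i => if i == k then z else 0) = (cmod z ^+ 2)%:E.
Proof.
rewrite /sqsum (@nneseries_split _ _ 0 k.+1); last first.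
  by move=> i _; rewrite lee_fin sqr_ge0.
rewrite add0n big_nat_recr//= eqxx big_nat big1 ?add0e; last first.
  by move=> i /andP[_ ik]; rewrite ltn_eqF// Normc.normc0 expr0n.
rewrite eseries0 ?adde0// => i ki _.
by rewrite gtn_eqF// Normc.normc0 expr0n.
Qed.

Lemma sqsummable_delta (z : R[i]) (k : nat) :
  sqsummable (fun i => if i == k then z else 0).
Proof. by rewrite /sqsummable sqsum_delta ltry. Qed.

Definition ell2_delta (k : nat) : ell2 R := Ell2 (sqsummable_delta 1 k).

End Ell2Norm.

(** * Combinatorics of the blocks *)

Section Blocks.

(* The coordinates are grouped in successive blocks of sizes 1, 2, 3, ...;
   [block k] counts the coordinates that precede and follow k in its block. *)
Definition block_step (s : nat * nat) : nat * nat :=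
  if s.2 is r.+1 then (s.1.+1, r) else (0%N, s.1.+1).

Definition block (k : nat) : nat * nat := iter k block_step (0, 0)%N.

Definition before (k : nat) : nat := (block k).1.
Definition after (k : nat) : nat := (block k).2.

Lemma blockD (k d : nat) : (d <= after k)%N ->
  block (k + d) = (before k + d, after k - d)%N.
Proof.
elim: d => [|d IH] dk; first by rewrite !addn0 subn0 -surjective_pairing.
rewrite addnS /block iterS -/(block _) IH 1?ltnW// /block_step/=.
by case: (after k - d)%N (subnSK dk) => [|r] //= [<-]; rewrite addnS.
Qed.

Lemma block_pred (k d : nat) : (d <= before k)%N ->
  [/\ (d <= k)%N, before (k - d) = (before k - d)%N &
      after (k - d) = (after k + d)%N].
Proof.
elim: d => [|d IH] dk; first by rewrite !subn0 addn0.
have [dk' hb ha] := IH (ltnW dk).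
have : (0 < before (k - d))%N by rewrite hb subn_gt0.
case E : (k - d)%N hb ha => [|j] // hb ha.
have -> : (k - d.+1 = j)%N by lia.
move: hb ha; rewrite /before /after /block iterS -/(block j).
(* If [j] were the last coordinate of its block, its successor would have [before] equal to 0,
   contradicting positivity. *)
case: (block j) => p [|r]; rewrite /block_step/= => hb ha h; last by split; lia.
by [].
Qed.

(** [k] and [j] lie in the same block, [k] not after [j]: the positions where powers of the shift
    can have nonzero entries. *)
Definition linked (j k : nat) : bool := (k <= j)%N && (j - k <= after k)%N.

Lemma linkedE (j d : nat) :
  (d <= j)%N && linked j (j - d) = (d <= before j)%N.
Proof.
apply/idP/idP => [/andP[dj /andP[_]]|].
  rewrite subKn// => h; have := blockD h; rewrite subnK// => E.
  by rewrite /before E /= leq_addl.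
move=> /block_pred[dj _ ha].
by rewrite /linked dj leq_subr/= subKn// ha leq_addl.
Qed.

Lemma block_start (N : nat) : exists k, block k = (0, N)%N.
Proof.
elim: N => [|N [k hk]]; first by exists 0%N.
(* The block starting at [k] ends at k + N; one more step opens the next block, which is longer by
   one. *)
exists (k + N.+1)%N; rewrite addnS /block iterS -/(block _).
rewrite blockD /before /after hk//=.
by rewrite subnn /block_step.
Qed.

End Blocks.

(** * Sums along rows and columns inside a block *)

Section LinkedSums.
Context (R : realType).
Implicit Type f : nat -> R.

(** Used to discard the truncation [n] of a Kreiss sum, which makes the final bound uniform in
    [n]. *)
Lemma sum_filter_lt_le f (n m : nat) : (forall i, 0 <= f i) ->
  \sum_(0 <= i < n | (i < m)%N) f i <= \sum_(0 <= i < m) f i.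
Proof.
move=> f0; rewrite [leRHS](big_nat_widen _ _ (n + m)) ?leq_addl//=.
rewrite [leRHS](big_cat_nat (n := n)) ?leq_addr//= lerDl.
by apply: sumr_ge0 => i _; exact: f0.
Qed.

Lemma linked_row_sum f (j M : nat) : (j < M)%N ->
  \sum_(0 <= k < M | linked j k) f k =
    \sum_(0 <= d < (before j).+1) f (j - d)%N.
Proof.
move=> jM; have [bj _ _] := block_pred (leqnn (before j)).
transitivity (\sum_(0 <= k < j.+1 | linked j k) f k).
  rewrite [RHS](big_nat_widen _ _ M)//=; apply: eq_bigl => k.
  by rewrite /linked ltnS; case: leqP => //= _; rewrite andbT.
rewrite big_nat_rev/= add0n [RHS](big_nat_widen _ _ j.+1) ?ltnS//=.
rewrite big_nat_cond [RHS]big_nat_cond; apply: eq_big => d;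
  last by rewrite subSS.
by rewrite subSS !ltnS -linkedE /=; case: (d <= j)%N.
Qed.

(** Unlike the predecessors of a row index, the successors of [k] in its block may pass the cutoff
    [M], hence only an inequality. *)
Lemma linked_col_sum_le f (k M : nat) : (forall i, 0 <= f i) ->
  \sum_(0 <= j < M | linked j k) f j <=
    \sum_(0 <= d < (after k).+1) f (k + d)%N.
Proof.
move=> f0.
have -> : \sum_(0 <= d < (after k).+1) f (k + d)%N =
    \sum_(0 <= j < k + (after k).+1) if (k <= j)%N then f j else 0.
  rewrite [RHS](big_cat_nat (n := k)) ?leq_addr//=.
  rewrite [X in _ = X + _]big_nat [X in _ = X + _]big1 ?add0r; last first.
    by move=> i /andP[_]; rewrite ltnNge => /negbTE->.
  rewrite -[k in RHS]add0n big_addn addKn; apply: eq_bigr => i _.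
  by rewrite leq_addl addnC.
apply: le_trans (sum_filter_lt_le _ _ _); last by move=> i; case: ifP.
apply: eq_ler.
rewrite big_mkcond [RHS]big_mkcond; apply: eq_bigr => j _.
rewrite /linked; case: (leqP k j) => /= kj; last by rewrite if_same.
by congr (if _ then _ else _); lia.
Qed.

End LinkedSums.

(** * Weights and matrix entries of the shift *)

Section WeightedShift.
Context (R : realType) (b : R).
Local Open Scope complex_scope.

(** The weight w_i of the block, with i = [before k] and N - i = [after k]. *)
Definition level (k : nat) : R :=
  ((before k).+1%:R / (after k).+1%:R) `^ (b / 2).

Lemma level_gt0 k : 0 < level k.
Proof. by rewrite powR_gt0// divr_gt0. Qed.

(** The (j, k) entry of the power j - k of the shift when k <= j, as [iter_shiftE] shows. *)
Definition gain (j k : nat) : R := if linked j k then level j / level k else 0.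

Lemma gain_ge0 j k : 0 <= gain j k.
Proof.
by rewrite /gain; case: ifP => // _; rewrite divr_ge0// ltW// level_gt0.
Qed.

Lemma linkedP j k : linked j k -> exists d,
  [/\ j = k + d, before j = before k + d & after k = after j + d]%N.
Proof.
move=> /andP[kj h]; exists (j - k)%N; have := blockD h.
rewrite subnKC// => E; split=> //; rewrite ?{1}/before ?{2}/after E//=.
by rewrite subnK.
Qed.

Lemma gain_le_edge (t : R) : 0 <= b -> 0 < t -> forall j k, gain j k <=
  (1 + t * (j - k)%:R) `^ b * edge b t (before k) * edge b t (after j).
Proof.
move=> b0 t0 j k; rewrite /gain.
case: ifP => [/linkedP[d [-> hb ha]]|_]; last by rewrite !mulr_ge0 ?powR_ge0.
rewrite addKn.
(* The growth of [before] and the decrease of [after] contribute one ratio each; each yields one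
   edge weight and half of the power (1 + t d)^b. *)
have -> : level (k + d) / level k =
    ((before k + d).+1%:R / (before k).+1%:R) `^ (b / 2) *
    ((after (k + d) + d).+1%:R / (after (k + d)).+1%:R) `^ (b / 2).
  rewrite /level hb ha !powR_div//.
  by field; rewrite !lt0r_neq0 ?powR_gt0.
have -> : (1 + t * d%:R) `^ b =
    (1 + t * d%:R) `^ (b / 2) * (1 + t * d%:R) `^ (b / 2).
  rewrite -powRD; first by congr (_ `^ _); field.
  by apply/implyP => _; rewrite lt0r_neq0// ltr_pwDl// mulr_ge0// ltW.
apply: le_trans (ler_pM _ _ (ratio_powR_le_edge _ _ b0 t0)
  (ratio_powR_le_edge _ _ b0 t0)) _; rewrite ?powR_ge0//.
by apply: eq_ler; ring.
Qed.

Lemma beforeS (k : nat) :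
  before k.+1 = if (0 < after k)%N then (before k).+1 else 0%N.
Proof.
by rewrite /before /after /block iterS; case: (iter k _ _) => p [|r].
Qed.

Lemma linkedS (k : nat) : linked k.+1 k = (0 < after k)%N.
Proof. by rewrite /linked leqnSn subSnn. Qed.

(** The case t = 1, d = 1 of [gain_le_edge]: the factors are 2^b and two edge weights of at most
    2^(b/2). *)
Lemma gainS_le (k : nat) : 0 <= b -> gain k.+1 k <= 4 `^ b.
Proof.
move=> b0; apply: le_trans (gain_le_edge b0 (@ltr01 R) _ _) _.
rewrite subSnn mulr1.
have edge_le j : edge b 1 j <= 2 `^ (b / 2).
  rewrite /edge mul1r; apply: ler_powR2; first exact: divr_ge0.
    by rewrite addr_ge0// invr_ge0.
  by rewrite -[leRHS]/(1 + 1) lerD2l invf_le1 ?ler1n.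
have -> : 4 `^ b = (1 + 1) `^ b * 2 `^ (b / 2) * 2 `^ (b / 2) :> R.
  rewrite -mulrA -powRD -?splitr; last by rewrite pnatr_eq0 implybT.
  by rewrite -powRM//; congr (_ `^ _); ring.
by rewrite !ler_pM ?mulr_ge0 ?powR_ge0.
Qed.

(** At the end of a block [gain k.+1 k] is 0, so one formula covers all blocks and keeps them
    decoupled. *)
Definition shift_seq (x : nat -> R[i]) (j : nat) : R[i] :=
  if j is k.+1 then (gain k.+1 k)%:C * x k else 0.

Lemma shift_seq_sqr_le (x : nat -> R[i]) (M : nat) : 0 <= b ->
  \sum_(0 <= k < M) cmod (shift_seq x k) ^+ 2 <=
    (4 `^ b) ^+ 2 * \sum_(0 <= k < M) cmod (x k) ^+ 2.
Proof.
move=> b0; case: M => [|M]; first by rewrite !big_geq// mulr0.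
rewrite big_nat_recl//= expr0n/= addr0 sqrtr0 expr0n add0r mulr_sumr.
rewrite [leRHS]big_nat_recr//= -[leLHS]addr0.
apply: lerD; last by rewrite mulr_ge0 ?sqr_ge0.
apply: ler_sum => k _; rewrite Normc.normcM cmod_real exprMn.
rewrite ler_wpM2r ?sqr_ge0// lerXn2r ?nnegrE ?powR_ge0//.
by rewrite ger0_norm ?gain_ge0 ?gainS_le.
Qed.

Lemma shift_sqsummable (x : ell2 R) : 0 <= b -> sqsummable (shift_seq x).
Proof.
move=> b0; apply: le_lt_trans (sqsum_le _) _.
  by move=> M; exact: shift_seq_sqr_le.
by rewrite lte_mul_pinfty ?lee_fin ?sqr_ge0//; exact: ell2P.
Qed.

End WeightedShift.

(** * The shift operator, its Kreiss bound and the growth of its powers *)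

Section ShiftOperator.
Context (R : realType) (b : R) (b1 : 1 < b).
Local Open Scope complex_scope.

Let b_gt0 : 0 < b. Proof. exact: lt_trans b1. Qed.
Let b_ge0 : 0 <= b. Proof. exact: ltW. Qed.

Definition shift (x : ell2 R) : ell2 R := Ell2 (shift_sqsummable x b_ge0).

Lemma shift_is_linear : linear shift.
Proof.
move=> a x y; apply/val_inj/funext => j.
change (shift (a *: x + y) j = a * shift x j + shift y j).
case: j => [|k] /=; first by rewrite mulr0 addr0.
by rewrite mulrCA -mulrDr.
Qed.

HB.instance Definition _ :=
  GRing.isLinear.Build R[i] (ell2 R) (ell2 R) *:%R shift shift_is_linear.

Lemma shift_bounded : bounded_op shift.
Proof.
exists (4 `^ b) => x; apply: l2norm_le; rewrite ?powR_ge0// => M.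
exact: shift_seq_sqr_le.
Qed.

Lemma shift_positive : positive_op shift.
Proof.
by move=> x x0 [|k] //=; rewrite mulr_ge0// ler0c gain_ge0.
Qed.

(** The ratios of levels telescope along a block; the condition on [d] says that j - d is still in
    the block of [j]. *)
Lemma iter_shiftE (x : ell2 R) (d j : nat) :
  iter d shift x j =
    if (d <= before j)%N then (gain b j (j - d))%:C * x (j - d)%N else 0.
Proof.
elim: d j => [|d IH] j /=.
  rewrite subn0 /gain /linked leqnn subnn/=.
  by rewrite divff ?lt0r_neq0 ?level_gt0// mul1r.
case: j => [|k] //=; rewrite IH subSS beforeS.
rewrite {1}/gain linkedS; case: (posnP (after k)) => [_|ak];
  first by rewrite mul0r.
rewrite ltnS; case: ifP => [dk|_]; last by rewrite mulr0.
have [dk' hb ha] := block_pred dk.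
have lk : linked k (k - d) by have := linkedE k d; rewrite dk dk'.
have lk1 : linked k.+1 (k - d).
  have := linkedE k.+1 d.+1; rewrite subSS beforeS ak !ltnS dk dk'.
  by [].
rewrite /gain lk lk1 mulrA -rmorphM/=; congr (_%:C * _).
by field; rewrite !lt0r_neq0 ?level_gt0.
Qed.

Lemma shift_kreiss : uniformly_kreiss_bounded b shift.
Proof.
have [C1 C10 hC1] := powR_le_expR b_gt0.
have [C2 C20 hC2] := edge_sum_bounded b1.
exists (C1 * C2); first by rewrite mulr_gt0.
move=> lambda n /andP[l1 l2] _.
set t := cmod lambda - 1.
have t0 : 0 < t by rewrite subr_gt0.
have t1 : t <= 1 by rewrite /t; lra.
have t01 : 0 < t <= 1 by rewrite t0.
have lE : cmod lambda = 1 + t by rewrite /t; lra.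
have tb : 0 < t `^ b by rewrite powR_gt0.
have c0 : 0 < C2 / t `^ b by rewrite divr_gt0.
have e_ge0 j : 0 <= edge b t j by exact: powR_ge0.
pose e (j k : nat) := expR (- (t * (j - k)%:R / 4)).
pose w (j k : nat) : R := if linked j k then e j k else 0.
apply: opnorm_le => [|x]; first by rewrite -mulrA mulr_ge0// ltW.
apply: l2norm_le => [|M]; first by rewrite -mulrA mulr_ge0// ltW.
(* Entrywise domination by a positive kernel: the phases of [lambda] and of [x] disappear here. *)
have bound j : (j < M)%N -> cmod (kreiss_sum shift lambda n x j) <=
    C1 * \sum_(0 <= k < M)
      w j k * edge b t (before k) * edge b t (after j) * cmod (x k).
  move=> jM; rewrite /kreiss_sum ell2_sum mulr_sumr.
  pose f k :=
    C1 * (e j k * edge b t (before k) * edge b t (after j) * cmod (x k)).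
  have f0 k : 0 <= f k by rewrite !mulr_ge0 ?cmod_ge0 ?expR_ge0// ltW.
  have -> : \sum_(0 <= k < M) C1 * (w j k * edge b t (before k) *
      edge b t (after j) * cmod (x k)) = \sum_(0 <= k < M | linked j k) f k.
    rewrite [RHS]big_mkcond; apply: eq_bigr => k _; rewrite /w /f.
    by case: ifP => //; rewrite !mul0r mulr0.
  rewrite linked_row_sum//.
  apply: le_trans (sum_filter_lt_le n.+1 _ _); last by move=> d; exact: f0.
  apply: le_trans (cmod_sum_le _ _ _) _.
  rewrite [leRHS]big_mkcond; apply: ler_sum => d _.
  rewrite ell2Z iter_shiftE ltnS; case: ifP => [dj|_]; last first.
    by rewrite mulr0 Normc.normc0.
  rewrite !Normc.normcM cmodVX cmod_real ger0_norm ?gain_ge0// lE /f mulrA.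
  rewrite [leRHS]mulrA ler_wpM2r ?cmod_ge0//.
  have [jd _ _] := block_pred dj.
  have s0 : 0 < 1 + t by rewrite addr_gt0.
  (* The exponent is d + 1; the surplus factor 1 / (1 + t) is at most 1 and is dropped. *)
  have hd : (1 + t) ^- d.+1 <= expR (- (t * d%:R / 2)).
    apply: le_trans (exprV_le_expR _ _); last by rewrite t1 ltW.
    rewrite lef_pV2 ?posrE ?exprn_gt0// exprS ler_peMl ?exprn_ge0 ?(ltW s0)//.
    by rewrite lerDl ltW.
  have hg := gain_le_edge b_ge0 t0 j (j - d).
  rewrite subKn// in hg.
  (* The factor (1 + t d)^b costs half of the decay; the other half is [e]. *)
  apply: (@le_trans _ _ (expR (- (t * d%:R / 2)) * (C1 * expR (t * d%:R / 4) *
     edge b t (before (j - d)) * edge b t (after j)))).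
    apply: ler_pM hd _; [by rewrite invr_ge0 exprn_ge0// ltW|exact: gain_ge0|].
    apply: le_trans hg _; rewrite !ler_wpM2r//; apply: hC1.
    by rewrite mulr_ge0// ltW.
  rewrite /e subKn//; apply: eq_ler.
  have -> : expR (- (t * d%:R / 4)) =
      expR (- (t * d%:R / 2)) * expR (t * d%:R / 4).
    by rewrite -expRD; congr expR; field.
  by ring.
apply: (@le_trans _ _ (\sum_(0 <= j < M) (C1 * \sum_(0 <= k < M)
    w j k * edge b t (before k) * edge b t (after j) * cmod (x k)) ^+ 2)).
  rewrite big_nat [leRHS]big_nat; apply: ler_sum => j /andP[_ jM].
  have h := bound j jM.
  by rewrite lerXn2r// nnegrE ?(le_trans _ h) ?cmod_ge0.
under eq_bigr do rewrite exprMn.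
rewrite -mulr_sumr -[C1 * C2 / _]mulrA exprMn -[leRHS]mulrA.
rewrite ler_wpM2l ?sqr_ge0//.
have w0 j k : 0 <= w j k by rewrite /w; case: ifP; rewrite ?expR_ge0.
(* Going back along a row [before] decreases, going forward along a column [after] does; both sums
   are thus instances of [edge_sum_bounded]. *)
apply: schur_test => // [j jM|k kM].
  pose f k := e j k * edge b t (before k) ^+ 2.
  have -> : \sum_(0 <= k < M) w j k * edge b t (before k) ^+ 2 =
      \sum_(0 <= k < M | linked j k) f k.
    rewrite [RHS]big_mkcond; apply: eq_bigr => k _; rewrite /w /f.
    by case: ifP => //; rewrite mul0r.
  rewrite linked_row_sum//; apply: le_trans (hC2 t (before j) t01).
  rewrite big_nat [leRHS]big_nat; apply: ler_sum => d /andP[_].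
  rewrite ltnS => dj; have [jd hb _] := block_pred dj.
  by rewrite /f /e subKn// hb.
pose f j := e j k * edge b t (after j) ^+ 2.
have -> : \sum_(0 <= j < M) w j k * edge b t (after j) ^+ 2 =
    \sum_(0 <= j < M | linked j k) f j.
  rewrite [RHS]big_mkcond; apply: eq_bigr => j _; rewrite /w /f.
  by case: ifP => //; rewrite mul0r.
apply: le_trans (linked_col_sum_le _ _ _) _.
  by move=> j; rewrite mulr_ge0 ?expR_ge0 ?sqr_ge0.
apply: le_trans (hC2 t (after k) t01).
rewrite big_nat [leRHS]big_nat; apply: ler_sum => d /andP[_].
by rewrite ltnS => /blockD h; rewrite /f /e addKn {1}/after h.
Qed.

Lemma shift_iter_opnorm_ge (N : nat) : N%:R `^ b <= opnorm (iter N shift).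
Proof.
have [k hk] := block_start N.
have hbk : before k = 0%N by rewrite /before hk.
have hak : after k = N by rewrite /after hk.
have hkN := blockD (leqnn (after k)); rewrite hak hbk add0n subnn in hkN.
have hl : linked (k + N) k by rewrite /linked leq_addr addKn hak leqnn.
have d1 : l2norm (ell2_delta R k) = 1.
  by rewrite /l2norm sqsum_delta Normc.normc1 expr1n sqrtr1.
have bN := bounded_op_iter N shift_bounded.
apply: le_trans (opnorm_ge (x := ell2_delta R k) bN _); last by rewrite d1.
have -> : l2norm (iter N shift (ell2_delta R k)) = gain b (k + N) k.
  rewrite /l2norm.
  have -> : ell2_seq (iter N shift (ell2_delta R k)) =
      fun i => if i == (k + N)%N then (gain b (k + N) k)%:C else 0.
    apply/funext => i; rewrite iter_shiftE /=.
    have [->|ik] := eqVneq i (k + N)%N.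
      by rewrite /before hkN /= leqnn addnK eqxx mulr1.
    (* Since N <= i, the subtraction is exact, so i - N = k would force i = k + N. *)
    case: ifP => // /block_pred[Ni _ _].
    by rewrite ifF ?mulr0//; apply/eqP => h; move/eqP: ik; lia.
  by rewrite sqsum_delta cmod_real /= sqrtr_sqr !ger0_norm ?gain_ge0.
(* The levels at the two ends of the block are (N + 1)^(b/2) and its inverse, so the ratio is (N +
   1)^b. *)
rewrite /gain hl /level /before /after hkN hk /= divr1.
rewrite powR_div// powR1 div1r invrK.
rewrite -powRD; last by rewrite pnatr_eq0 implybT.
by rewrite -splitr ler_powR2// ler_nat.
Qed.

End ShiftOperator.

Theorem proposition5p13 (R : realType) (beta : R) (beta_gt1 : 1 < beta) :
  exists T : {linear ell2 R -> ell2 R},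
    [/\ bounded_op T,
        positive_op T,
        uniformly_kreiss_bounded beta T &
        exists2 C : R, 0 < C &
          forall N : nat, (0 < N)%N -> C * (N%:R `^ beta) <= opnorm (iter N T)].
Proof.
exists (shift beta_gt1); split.
- exact: shift_bounded.
- exact: shift_positive.
- exact: shift_kreiss.
- by exists 1 => // N _; rewrite mul1r; exact: shift_iter_opnorm_ge.
Qed.
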